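(* Let $D$ be a positive integer and let $\mathcal{G}_n=(V_n,E_n)$, $n\in\mathbb{N}$, be a sequence of finite trees, each with at least three vertices, such that every vertex of every $\mathcal{G}_n$ has degree at most $D$. If $|V_n|\to\infty$ as $n\to\infty$, then the first nonzero Steklov eigenvalues $\lambda_2(\mathcal{G}_n)$ satisfy $$\lim_{n\to\infty}\lambda_2(\mathcal{G}_n)=0.$$
   Context: Let $\mathcal{G}=(V,E)$ be a finite tree (simple, undirected, unweighted) with at least three vertices. Its boundary $\delta\Omega$ is the set of vertices of degree one and its interior is $\Omega=V\setminus\delta\Omega$; $|\cdot|$ denotes cardinality. The Steklov problem on $(\mathcal{G},\delta\Omega)$ is: for nonzero $f\in\mathbb{R}^V$ and $\lambda\in\mathbb{R}$, $\Delta f(x)=0$ for $x\in\Omega$ and $\frac{\partial f}{\partial n}(x)=\lambda f(x)$ for $x\in\delta\Omega$, where $(\Delta f)(x)=\sum_{y\sim x}(f(x)-f(y))$ and $\frac{\partial f}{\partial n}(x)=\sum_{y\in\Omega,\,y\sim x}(f(x)-f(y))$. The Steklov eigenvalues are the eigenvalues of the Dirichlet-to-Neumann operator on $\mathbb{R}^{\delta\Omega}$, $f\mapsto \frac{\partial\hat f}{\partial n}$, where $\hat f$ is the harmonic extension of $f$ ($\Delta\hat f=0$ on $\Omega$, $\hat f=f$ on $\delta\Omega$). This operator is self-adjoint and non-negative; its eigenvalues, counted with multiplicity, are ordered $0=\lambda_1\le\lambda_2\le\cdots\le\lambda_{|\delta\Omega|}$, and $\lambda_2(\mathcal{G})$ denotes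 the second of these. *)

(* Defs.v *)
From HB Require Import structures.
From mathcomp Require Import all_boot all_order all_algebra.
From mathcomp Require Import polyrcf.
From mathcomp Require Import all_classical all_reals all_analysis.

Set Implicit Arguments.
Unset Strict Implicit.
Unset Printing Implicit Defensive.

Import Order.TTheory GRing.Theory Num.Theory.
Import numFieldNormedType.Exports.

Local Open Scope classical_set_scope.
Local Open Scope ring_scope.

(* A walk x, y, x along an edge is a duplicate-free [cycle] of size 2, so graph
   cycles are the duplicate-free cycles of size at least 3. *)
Definition is_tree (V : finType) (e : rel V) : Prop :=
  [/\ symmetric e, irreflexive e, (forall x y, connect e x y) &
      forall c : seq V, uniq c -> cycle e c -> (size c <= 2)%N].

Definition degree (V : finType) (e : rel V) (x : V) : nat :=
  #|[pred y | e x y]|.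

Definition boundary (V : finType) (e : rel V) : {set V} :=
  [set x : V | degree e x == 1%N].

Definition interior_vertices (V : finType) (e : rel V) : {set V} :=
  ~: boundary e.

Section Steklov.
Variables (R : realType) (V : finType) (e : rel V).

Definition laplacian (f : {ffun V -> R}) (x : V) : R :=
  \sum_(y | e x y) (f x - f y).

Definition normal_derivative (f : {ffun V -> R}) (x : V) : R :=
  \sum_(y in interior_vertices e | e x y) (f x - f y).

(* A function on the boundary is a row vector [f : 'rV_#|boundary e|], where
   [f 0 i] is the value at the boundary vertex [enum_val i]. *)
Definition is_harmonic_extension (f : 'rV[R]_#|boundary e|)
    (u : {ffun V -> R}) : Prop :=
  (forall x, x \in interior_vertices e -> laplacian u x = 0) /\
  (forall i, u (enum_val i) = f 0 i).

(* On a tree with at least three vertices exactly one [u] satisfies the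
   condition, so the default value 0 of [xget] is never used. *)
Definition harmonic_extension (f : 'rV[R]_#|boundary e|) : {ffun V -> R} :=
  xget [ffun=> 0] [set u | is_harmonic_extension f u].

Definition dirichlet_to_neumann (f : 'rV[R]_#|boundary e|) :
    'rV[R]_#|boundary e| :=
  \row_i normal_derivative (harmonic_extension f) (enum_val i).

(* The nondecreasing list of the eigenvalues, each repeated as many times as its
   multiplicity as a root of the characteristic polynomial; [rootsR] lists the
   distinct real roots in increasing order. *)
Definition steklov_spectrum : seq R :=
  let p := char_poly (lin1_mx dirichlet_to_neumann) in
  flatten [seq nseq (mup x p) x | x <- rootsR p].

(* A tree with at least three vertices has at least two leaves, and the operator
   is self-adjoint, so the list has at least two items; the default value is
   taken to be nonzero so that it could not produce a spurious limit 0. *)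
Definition steklov_lambda2 : R := nth 1 steklov_spectrum 1.

End Steklov.

Arguments steklov_lambda2 R {V} e.

(* Main.v *)
From HB Require Import structures.
Require Import Defs.
From mathcomp Require Import all_boot all_order all_algebra.
From mathcomp Require Import spectral sesquilinear complex polyrcf.
From mathcomp Require Import all_classical all_reals all_analysis.
From mathcomp Require Import ring lra zify.

(** The reason is that the second Steklov eigenvalue of a finite tree is at most
    [2 / L], where [L] is the length of a longest simple path: a tree with
    bounded degrees and many vertices has to contain a long path.

    A longest simple path of a tree joins two leaves [a] and [b]
    ([longest_path_leaf]), and the ball of radius [L] around [a] is the whole
    tree, so that the number of vertices is at most [(D + 1) ^ L]
    ([tree_long_path]). Hence [L] tends to infinity.

    The bound [2 / L] comes from one test function. Let [g x] be the number of
    edges of the path that separate [x] from [b], subtracted from [L]; this is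
    the position along the path of the projection of [x] onto it
    ([path_potential]). Since every edge of a tree is a bridge
    ([tree_bridge]), [g] runs from 0 at [a] to [L] at [b]. It changes by 1
    along each edge of the path and is constant along all the others, so its
    Dirichlet energy is at most [L] ([path_potential_dirichlet]). Whatever its
    mean [m] over the boundary, the sum of [(g x - m) ^ 2] over the leaves is
    at least its part at [a] and [b], which is at least [L ^ 2 / 2]. The
    Rayleigh quotient of [g - m] is thus at most [L / (L ^ 2 / 2) = 2 / L].

    To turn this into a bound on the second item of the list of eigenvalues
    ([steklov_lambda2_le]), one needs that the Dirichlet-to-Neumann matrix is
    symmetric and positive semidefinite and kills the constants. The first two
    properties follow from the identity between its quadratic form and the Dirichlet
    energy of harmonic extensions ([dtn_mx_form]), which is a discrete Green
    formula; and the energy of the harmonic extension is at most that of any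
    other extension ([dtn_mx_le_dirichlet]). The rest is linear algebra: if [M]
    is symmetric and positive semidefinite, with a null vector [v0], then the
    Rayleigh quotient of a vector orthogonal to [v0] bounds from above the
    second root of the characteristic polynomial
    ([symmetric_second_eigenvalue]). *)

Set Implicit Arguments.
Unset Strict Implicit.
Unset Printing Implicit Defensive.

Import Order.TTheory GRing.Theory Num.Theory.
Import numFieldNormedType.Exports.

Local Open Scope ring_scope.

(** * The second eigenvalue of a positive semidefinite symmetric matrix *)

(** With [p] the characteristic polynomial of the Dirichlet-to-Neumann matrix,
    this is the list whose second item defines [steklov_lambda2]. *)
Definition roots_with_mult (R : rcfType) (p : {poly R}) : seq R :=
  flatten [seq nseq (mup x p) x | x <- rootsR p].

Lemma sorted_flatten_nseq (R : realDomainType) (k : R -> nat) (s : seq R) :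
  sorted <=%R s -> sorted <=%R (flatten [seq nseq (k x) x | x <- s]).
Proof.
have le_trans' : transitive (<=%R : rel R) by exact: le_trans.
rewrite !(sorted_pairwise le_trans').
elim: s => //= x s IHs /andP[/allP x_le /IHs s_sorted].
rewrite pairwise_cat s_sorted andbT; apply/andP; split; last first.
  by rewrite -(sorted_pairwise le_trans'); elim: (k x) => //= -[|m] //= ->; rewrite lexx.
apply/allrelP => y z /nseqP[-> _] /flattenP[_ /mapP[t t_s ->]] /nseqP[-> _].
exact: x_le.
Qed.

Lemma roots_with_mult_sorted (R : rcfType) (p : {poly R}) :
  sorted <=%R (roots_with_mult p).
Proof.
apply: sorted_flatten_nseq; apply: sub_sorted (sorted_roots _ _ _).
by move=> x y /ltW.
Qed.

Lemma count_flatten_nseq (T : eqType) (k : T -> nat) (s : seq T) (y : T) :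
  uniq s ->
  count_mem y (flatten [seq nseq (k x) x | x <- s]) = if y \in s then k y else 0%N.
Proof.
elim: s => //= x s IHs /andP[x_s s_uniq].
rewrite count_cat count_nseq /= IHs // inE [y == x]eq_sym.
by case: eqVneq => [<-|]; rewrite ?(negPf x_s) ?mul1n ?addn0 ?mul0n.
Qed.

Lemma roots_with_mult_prod (R : rcfType) (s : seq R) :
  perm_eq (roots_with_mult (\prod_(x <- s) ('X - x%:P))) s.
Proof.
set p := \prod_(x <- s) _.
have p_neq0 : p != 0 by rewrite monic_neq0 ?monic_prod_XsubC.
have uniq_roots : uniq (rootsR p).
  by apply: (sorted_uniq lt_trans ltxx); exact: sorted_roots.
apply/allP => x _ /=; rewrite count_flatten_nseq //.
rewrite -(roots_on_rootsR p_neq0) in_itv /= -(mu_prod_XsubC x s).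
by have [//|px] := boolP (root p x); rewrite mupNroot.
Qed.

Lemma sorted_nth1_le (R : realDomainType) (x0 c : R) (s : seq R) :
  sorted <=%R s -> (2 <= count (<= c) s)%N -> nth x0 s 1 <= c.
Proof.
case: s => [|a [|b t]] //=; first by case: (a <= c).
case/andP=> _ /(order_path_min le_trans)/allP b_le.
apply: contraTT; rewrite -ltNge => c_b; rewrite [b <= c]leNgt c_b /=.
suff /eqP -> : count (<= c) t == 0%N by case: (a <= c).
rewrite -leqn0 leqNgt -has_count; apply/hasPn => y /b_le /(lt_le_trans c_b).
by rewrite ltNge.
Qed.

Lemma hermitian_unitary_diag (C : numClosedFieldType) n (A : 'M[C]_n) :
  A \is hermsymmx ->
  exists (P : 'M[C]_n) (d : 'rV[C]_n),
    [/\ P \is unitarymx, d \is a mxOver Num.real &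
        A = map_mx Num.conj P^T *m diag_mx d *m P].
Proof.
move=> herm; have /orthomx_spectralP A_eq := hermitian_normalmx herm.
exists (spectralmx A), (spectral_diag A); split.
- exact: spectral_unitarymx.
- exact: hermitian_spectral_diag_real.
- by rewrite -invmx_unitary ?spectral_unitarymx.
Qed.

(** An eigenvector [v] for [x] gives [x |v|^2 = v M v^T >= 0]. *)
Lemma psd_root_ge0 (R : realFieldType) n (M : 'M[R]_n) x :
  (forall v : 'rV[R]_n, 0 <= (v *m M *m v^T) 0 0) -> root (char_poly M) x -> 0 <= x.
Proof.
move=> M_psd; rewrite -eigenvalue_root_char => /eigenvalueP[v vM v_neq0].
have := M_psd v; rewrite vM -scalemxAl mxE.
suff vv : 0 < (v *m v^T) 0 0 by rewrite pmulr_lge0.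
rewrite mxE lt0r; apply/andP; split; last first.
  by apply: sumr_ge0 => i _; rewrite mxE -expr2 sqr_ge0.
apply: contra_neq v_neq0 => /eqP vv0; apply/rowP => i.
move: vv0; rewrite psumr_eq0 => [/allP/(_ i)|j _]; last first.
  by rewrite mxE -expr2 sqr_ge0.
by rewrite mem_index_enum mxE mulf_eq0 orbb mxE => /(_ isT)/eqP.
Qed.

(** The spectral theorem is about Hermitian matrices over a closed field, so a
    real symmetric matrix is diagonalised over a closed field [C] whose real
    elements are exactly the image of [R] under [tc]. *)
Section SymmetricMatrix.
Variables (R : rcfType) (C : numClosedFieldType) (tc : {rmorphism R -> C}).
Hypothesis tc_le : forall x y, (tc x <= tc y) = (x <= y).
Hypothesis tc_realP : forall z, reflect (exists x, z = tc x) (z \is Num.real).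
Variables (n : nat) (M : 'M[R]_n).
Hypothesis M_sym : M^T = M.
Local Notation cx A := (map_mx tc A).
Local Open Scope sesquilinear_scope.

Lemma conj_real m p (A : 'M[R]_(m, p)) : (cx A) ^t* = cx A^T.
Proof.
apply/matrixP => i j; rewrite !mxE; apply: conj_Creal.
by apply/tc_realP; exists (A j i).
Qed.

Lemma symmetric_spectral : exists (P : 'M[C]_n) (d : 'rV[R]_n),
  P \is unitarymx /\ cx M = P ^t* *m diag_mx (cx d) *m P.
Proof.
have herm : cx M \is hermsymmx.
  by apply/is_hermitianmxP; rewrite expr0 scale1r conj_real M_sym.
have [P [d [P_unitary d_real M_eq]]] := hermitian_unitary_diag herm.
have d_tc i : exists x, d 0 i == tc x.
  by have /tc_realP[x ->] := mxOverP d_real 0 i; exists x.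
exists P, (\row_i xchoose (d_tc i)); split; first exact: P_unitary.
suff -> : cx (\row_i xchoose (d_tc i)) = d by [].
by apply/rowP => i; rewrite !mxE; apply/esym/eqP/(xchooseP (d_tc i)).
Qed.

(** The diagonalisation takes place over [C], but both sides have their
    coefficients in [R], and [tc] is injective on polynomials. *)
Lemma char_poly_spectral (P : 'M[C]_n) (d : 'rV[R]_n) :
  P \is unitarymx -> cx M = P ^t* *m diag_mx (cx d) *m P ->
  char_poly M = \prod_(i < n) ('X - (d 0 i)%:P).
Proof.
move=> P_unitary M_eq.
have P_unit := unitarymx_unit P_unitary.
apply: (map_poly_inj tc).
rewrite map_char_poly M_eq -invmx_unitary //.
transitivity (char_poly (diag_mx (cx d))).
  rewrite /char_poly /char_poly_mx.
  have -> : 'X%:M - map_mx polyC (invmx P *m diag_mx (cx d) *m P) =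
    map_mx polyC (invmx P) *m ('X%:M - map_mx polyC (diag_mx (cx d))) *m map_mx polyC P.
    rewrite mulmxBr mulmxBl !map_mxM; congr (_ - _).
    by rewrite scalar_mxC -mulmxA -map_mxM mulVmx // map_mx1 mulmx1.
  rewrite !det_mulmx mulrAC -det_mulmx -map_mxM mulVmx // map_mx1 det1 mul1r //.
rewrite char_poly_trig ?diag_mx_is_trig // rmorph_prod /=.
apply: eq_bigr => i _; rewrite !mxE eqxx mulr1n.
by rewrite rmorphB /= map_polyX map_polyC.
Qed.

Hypothesis M_psd : forall v : 'rV[R]_n, 0 <= (v *m M *m v^T) 0 0.

(** If at most one eigenvalue were at most [c], it would be the eigenvalue 0 of
    [v0], and [v0] would be a multiple of its eigenvector. As [v] is orthogonal
    to [v0], it would be a combination of eigenvectors for eigenvalues greater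
    than [c], and its Rayleigh quotient would exceed [c]. *)
Lemma symmetric_second_eigenvalue_closed (v0 v : 'rV[R]_n) (c : R) :
  0 <= c -> v0 != 0 -> v0 *m M = 0 -> v != 0 -> v *m v0^T = 0 ->
  (v *m M *m v^T) 0 0 <= c * (v *m v^T) 0 0 ->
  0 <= nth 1 (roots_with_mult (char_poly M)) 1 <= c.
Proof.
move=> c_ge0 v0_neq0 v0M v_neq0 vv0 v_le.
have [P [d [P_unitary M_eq]]] := symmetric_spectral.
have char_eq := char_poly_spectral P_unitary M_eq.
pose s := [seq d 0 i | i <- index_enum 'I_n].
rewrite -(big_map (fun i => d 0 i) xpredT (fun x => 'X - x%:P)) -/s in char_eq.
have spec_s : perm_eq (roots_with_mult (char_poly M)) s.
  by rewrite char_eq roots_with_mult_prod.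
have d_ge0 i : 0 <= d 0 i.
  apply: (psd_root_ge0 M_psd); rewrite char_eq root_prod_XsubC.
  by apply: map_f; rewrite mem_index_enum.
apply/andP; split.
  have [lt1|ge1] := ltnP 1 (size (roots_with_mult (char_poly M))); last first.
    by rewrite nth_default.
  have := mem_nth 1 lt1; rewrite (perm_mem spec_s) => /mapP[i _ ->] //.
apply: sorted_nth1_le; first exact: roots_with_mult_sorted.
rewrite (permP spec_s) count_map -sum1_count.
have PP : P ^t* *m P = 1%:M by rewrite -invmx_unitary // mulVmx // unitarymx_unit.
(* [w] and [w0] are the coordinates of [v] and [v0] in the eigenbasis. *)
pose w := cx v *m P ^t*; pose w0 := cx v0 *m P ^t*.
have dotE (x y : 'rV[R]_n) (D : 'M[C]_n) :
    (cx x *m P ^t*) *m D *m (cx y *m P ^t*) ^t* = cx x *m (P ^t* *m D *m P) *m cx y^T.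
  by rewrite trmx_mul map_mxM /= conj_real trmxCK !mulmxA.
have w0_ker i : w0 0 i * tc (d 0 i) = 0.
  have : w0 *m diag_mx (cx d) = 0.
    have /(congr1 (fun A => A *m P ^t*)) : cx v0 *m cx M = 0 by rewrite -map_mxM v0M map_mx0.
    rewrite M_eq -!mulmxA (unitarymxP P_unitary) mulmx1 mul0mx => <-.
    by rewrite mulmxA.
  by move/rowP/(_ i); rewrite mul_mx_diag !mxE.
have tc_inj0 x : tc x = 0 -> x = 0 by move/eqP; rewrite fmorph_eq0 => /eqP.
have w_w0 : \sum_i w 0 i * (w0 0 i)^* = 0.
  transitivity ((w *m 1%:M *m w0 ^t*) 0 0).
    by rewrite mulmx1 mxE; apply: eq_bigr => i _; rewrite [(w0 ^t*) _ _]mxE [w0^T _ _]mxE.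
  by rewrite /w /w0 dotE mulmx1 PP mulmx1 -map_mxM vv0 map_mx0 mxE.
have w_le : \sum_i tc (d 0 i - c) * (w 0 i * (w 0 i)^*) <= 0.
  have : tc ((v *m M *m v^T) 0 0 - c * (v *m v^T) 0 0) <= 0.
    by rewrite -(rmorph0 tc) tc_le subr_le0.
  congr (_ <= 0).
  have vMv : (cx (v *m M *m v^T)) 0 0 = (w *m diag_mx (cx d) *m w ^t*) 0 0.
    by rewrite /w dotE -M_eq !map_mxM.
  have vv : (cx (v *m v^T)) 0 0 = (w *m w ^t*) 0 0.
    transitivity ((w *m 1%:M *m w ^t*) 0 0); last by rewrite mulmx1.
    by rewrite /w dotE mulmx1 PP mulmx1 -!map_mxM.
  rewrite mxE in vMv; rewrite mxE in vv.
  rewrite rmorphB rmorphM /= vv vMv [(w *m _ *m _) 0 0]mxE [(w *m _) 0 0]mxE mulr_sumr -sumrB.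
  apply: eq_bigr => i _; rewrite mul_mx_diag [(w ^t*) _ _]mxE [w^T _ _]mxE.
  by rewrite [(\matrix_(_, _) _) _ _]mxE [cx d _ _]mxE rmorphB /=; ring.
rewrite leqNgt ltnS; apply/negP => count_le.
have norm_ge0 i : 0 <= w 0 i * (w 0 i)^* by exact: mul_conjC_ge0.
(* [i0] is the only index of an eigenvalue at most [c]. *)
have [i0 w0_i0] : exists i, w0 0 i != 0.
  apply/existsP; apply: contra_neqT v0_neq0; rewrite negb_exists => /forallP w0_eq0.
  have w00 : w0 = 0.
    by apply/rowP => i; rewrite [RHS]mxE; apply/eqP; have := w0_eq0 i; rewrite negbK.
  apply: (map_mx_inj (f := tc)); rewrite map_mx0.
  by rewrite -[LHS]mulmx1 -PP mulmxA -/w0 w00 mul0mx.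
have d_i0 : d 0 i0 = 0.
  by move/eqP: (w0_ker i0); rewrite mulf_eq0 (negPf w0_i0) /= => /eqP/tc_inj0.
have d_gt j : j != i0 -> c < d 0 j.
  move=> j_i0; rewrite ltNge; apply: contraTN count_le => d_j; rewrite -ltnNge.
  rewrite (bigD1 i0) /= ?d_i0 // (bigD1 j) //= j_i0 andbT //.
have w0_eq0 j : j != i0 -> w0 0 j = 0.
  move=> /d_gt c_d; apply/eqP; move/eqP: (w0_ker j); rewrite mulf_eq0 => /orP[//|].
  by move/eqP/tc_inj0 => d0; move: c_d; rewrite d0 ltNge c_ge0.
(* Only the index [i0] contributes to the scalar product of [v] and [v0]. *)
have w_i0 : w 0 i0 = 0.
  move: w_w0; rewrite (bigD1 i0) //= big1 ?addr0 => [/eqP|j j_i0]; last first.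
    by rewrite w0_eq0 // conjC0 mulr0.
  by rewrite mulf_eq0 conjC_eq0 (negPf w0_i0) orbF => /eqP.
have w_eq0 j : w 0 j = 0.
  have [->//|j_i0] := eqVneq j i0.
  have term_ge0 k : k != i0 -> 0 <= tc (d 0 k - c) * (w 0 k * (w 0 k)^*).
    by move=> k_i0; rewrite mulr_ge0 // -(rmorph0 tc) tc_le subr_ge0 ltW ?d_gt.
  move: w_le; rewrite (bigD1 i0) //= w_i0 mul0r mulr0 add0r => w_le.
  have /eqP : \sum_(k | k != i0) tc (d 0 k - c) * (w 0 k * (w 0 k)^*) = 0.
    by apply/eqP; rewrite eq_le w_le sumr_ge0.
  rewrite psumr_eq0 // => /allP/(_ j); rewrite mem_index_enum j_i0 => /(_ isT)/eqP/eqP.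
  rewrite !mulf_eq0 conjC_eq0 orbb => /orP[/eqP/tc_inj0/eqP|/eqP //].
  by rewrite subr_eq0 => /eqP d_j; move: (d_gt j j_i0); rewrite d_j ltxx.
move/eqP: v_neq0; apply; apply: (map_mx_inj (f := tc)); rewrite map_mx0.
rewrite -[LHS]mulmx1 -PP mulmxA -/w.
by have -> : w = 0 by [apply/rowP => j; rewrite [RHS]mxE w_eq0]; rewrite mul0mx.
Qed.
End SymmetricMatrix.

(** The upper half of the minimax principle for the second eigenvalue; [R[i]] is
    the closed field over which the matrix is diagonalised. *)
Theorem symmetric_second_eigenvalue (R : rcfType) n (M : 'M[R]_n)
    (v0 v : 'rV[R]_n) (c : R) :
  M^T = M -> (forall v : 'rV[R]_n, 0 <= (v *m M *m v^T) 0 0) ->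
  0 <= c -> v0 != 0 -> v0 *m M = 0 -> v != 0 -> v *m v0^T = 0 ->
  (v *m M *m v^T) 0 0 <= c * (v *m v^T) 0 0 ->
  0 <= nth 1 (roots_with_mult (char_poly M)) 1 <= c.
Proof.
move=> M_sym M_psd.
exact: (symmetric_second_eigenvalue_closed (@lecR R) (@complex_realP R)).
Qed.

(** * Long paths in trees of bounded degree *)

Section Graph.
Variables (V : finType) (e : rel V).

Definition delete_edge (x y : V) : rel V :=
  [rel z t | e z t && ~~ ([&& z == x & t == y] || [&& z == y & t == x])].

Lemma delete_edge_sym x y : symmetric e -> symmetric (delete_edge x y).
Proof.
move=> e_sym z t; rewrite /delete_edge /= e_sym; congr (_ && ~~ _).
by rewrite orbC [(t == y) && _]andbC [(t == x) && _]andbC.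
Qed.

(** A simple path from [y] to [x] that avoids the edge has at least two edges,
    and closes up with it into a cycle of size at least 3. *)
Lemma tree_bridge x y : is_tree e -> e x y -> ~~ connect (delete_edge x y) y x.
Proof.
case=> e_sym e_irr _ acyclic exy; apply/negP => /connectP[p0 p0_path].
case/shortenP: p0_path => p p_path p_uniq _ x_last.
have ep : path e y p by apply: sub_path p_path => z t /andP[].
have := acyclic (y :: p) p_uniq; rewrite /= rcons_path ep -x_last exy => /(_ isT).
case: p p_path {p_uniq ep} x_last => [|z [|//]] /=; last first.
  by move=> + xz; rewrite -xz /delete_edge /= !eqxx /= orbT andbF.
by move=> _ xy; move: exy; rewrite xy e_irr.
Qed.

(** Two adjacent leaves would form a connected component of their own. *)
Lemma leaf_neighbor_interior x y : symmetric e -> (forall x y, connect e x y) ->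
  (3 <= #|V|)%N -> x \in boundary e -> e x y -> y \in interior_vertices e.
Proof.
move=> e_sym e_conn V_ge3; rewrite !inE => deg_x exy; apply/negP => deg_y.
have only z t t' : degree e z == 1%N -> e z t -> e z t' -> t = t'.
  move=> /eqP deg_z ezt ezt'.
  have /card_le1_eqP/(_ t' t) : (degree e z <= 1)%N by rewrite deg_z.
  by apply.
have xy_closed : fingraph.closed e [set x; y].
  apply: intro_closed => [|z t ezt]; first exact: sym_connect_sym.
  rewrite !inE => /orP[/eqP zx|/eqP zy]; subst z.
  - by rewrite (only _ _ _ deg_x ezt exy) eqxx orbT.
  - by rewrite e_sym in exy; rewrite (only _ _ _ deg_y ezt exy) eqxx.
have : (#|V| <= #|[set x; y]|)%N.
  rewrite -cardsT subset_leq_card //; apply/fintype.subsetP => z _.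
  by rewrite -(closed_connect xy_closed (e_conn x z)) !inE eqxx.
by rewrite cards2; move: V_ge3; case: (x != y) => /=; lia.
Qed.

Definition simple_path (a : V) (p : seq V) := path e a p && uniq (a :: p).

(** A neighbour of the starting point [a] outside the path would extend it, and
    one on the path other than the second vertex would close a cycle. *)
Lemma longest_path_leaf a p : is_tree e -> simple_path a p -> (0 < size p)%N ->
  (forall a' p', simple_path a' p' -> (size p' <= size p)%N) -> a \in boundary e.
Proof.
case=> e_sym e_irr _ acyclic /andP[]; case: p => // x p a_path a_uniq _ longest.
suff nbr z : e a z -> z = x.
  rewrite inE /degree; apply/eqP/(fintype.eq_card1 (x := x)) => z.
  rewrite !inE; apply/idP/eqP => [/nbr //|->].
  by case/andP: a_path.
move=> eaz.
have z_in : z \in x :: p.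
  have : z \in a :: x :: p.
    apply/negPn/negP => z_notin.
    have /longest : simple_path z (a :: x :: p).
      apply/andP; split; last by rewrite cons_uniq z_notin.
      by rewrite /= e_sym eaz; exact: a_path.
    by rewrite /= ltnn.
  by rewrite inE => /orP[/eqP za|//]; move: eaz; rewrite za e_irr.
move: z_in a_path a_uniq; rewrite inE => /orP[/eqP //|].
case/splitPr => p1 p2 a_path a_uniq.
have c_uniq : uniq (a :: x :: rcons p1 z).
  apply: subseq_uniq a_uniq; rewrite /= !eqxx -cat_rcons.
  exact: prefix_subseq.
have c_cycle : cycle e (a :: x :: rcons p1 z).
  move: a_path; rewrite -cat_rcons /= cat_path => /and3P[-> p1z _].
  by rewrite rcons_path p1z last_rcons e_sym eaz.
by have := acyclic _ c_uniq c_cycle; rewrite /= size_rcons; lia.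
Qed.

Fixpoint graph_ball (a : V) (k : nat) : {set V} :=
  if k is k'.+1 then \bigcup_(x in graph_ball a k') (x |: [set y | e x y]) else [set a].

Lemma card_graph_ball D a k : (forall x, degree e x <= D)%N -> (#|graph_ball a k| <= D.+1 ^ k)%N.
Proof.
move=> deg_le; elim: k => [|k IHk] /=; first by rewrite cards1.
rewrite expnS; apply: (@leq_trans (\sum_(x in graph_ball a k) D.+1)); last first.
  by rewrite sum_nat_const mulnC leq_mul2l IHk orbT.
apply: leq_trans (_ : (\sum_(x in graph_ball a k) #|x |: [set y | e x y]| <= _)%N).
  elim/big_rec2: _ => [|x m A _ leAm]; first by rewrite cards0.
  by rewrite (leq_trans (leq_card_setU _ _)) // leq_add2l.
apply: leq_sum => x _; apply: leq_trans (leq_card_setU _ _) _.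
by rewrite cards1 add1n ltnS cardsE deg_le.
Qed.

Lemma graph_ball_path a p : path e a p -> last a p \in graph_ball a (size p).
Proof.
elim/last_ind: p => [|p x IHp] /=; first by rewrite inE.
rewrite rcons_path last_rcons size_rcons => /andP[/IHp p_ball e_x] /=.
by apply/finset.bigcupP; exists (last a p) => //; rewrite !inE e_x orbT.
Qed.

Lemma graph_ball_mono a k l : (k <= l)%N -> graph_ball a k \subset graph_ball a l.
Proof.
move/subnK <-; elim: (l - k)%N => //= m IHm; apply: fintype.subset_trans IHm _.
by apply/fintype.subsetP => x x_ball; apply/finset.bigcupP; exists x; rewrite ?inE ?eqxx.
Qed.

(** A longest simple path has leaves at both of its ends, because its reversal
    is a longest path too; and no vertex is farther from [a] than its length,
    so that the ball of that radius contains every vertex. *)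
Lemma tree_long_path D : is_tree e -> (2 <= #|V|)%N ->
  (forall x, degree e x <= D)%N ->
  exists a p, [/\ simple_path a p, (0 < size p)%N, a \in boundary e,
    last a p \in boundary e & (#|V| <= D.+1 ^ size p)%N].
Proof.
move=> tree V_ge2 deg_le; have [e_sym e_irr e_conn _] := tree.
have [x [y x_y]] : exists x y : V, x != y.
  have /card_gt1P[x [y [_ _ xy]]] : (1 < #|V|)%N by []. 
  by exists x, y.
have to_path z t : exists2 p, simple_path z p & t = last z p.
  have /connectP[p0 + ->] := e_conn z t.
  by case/shortenP => p p_path p_uniq _; exists p => //; apply/andP.
pose has_path n := [exists a : V, [exists q : n.-tuple V, simple_path a q]].
have has_pathP n : reflect (exists a p, simple_path a p /\ size p = n) (has_path n).
  apply: (iffP existsP) => [[a /existsP[q q_simple]]|[a [p [p_simple size_p]]]].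
    by exists a, q; rewrite size_tuple.
  exists a; apply/existsP; have /eqP size_p' := size_p.
  by exists (Tuple size_p').
have ex_path : exists n, has_path n.
  by exists 0%N; apply/has_pathP; exists x, [::].
have path_le n : has_path n -> (n <= #|V|)%N.
  case/has_pathP => a [p [/andP[_ /card_uniqP card_p] <-]].
  by apply: ltnW; rewrite -[_.+1]card_p max_card.
case: (ex_maxnP ex_path path_le) => L /has_pathP[a [p [p_simple size_p]]] L_max.
have longest a' p' : simple_path a' p' -> (size p' <= size p)%N.
  by move=> p'_simple; rewrite size_p; apply: L_max; apply/has_pathP; exists a', p'.
have p_gt0 : (0 < size p)%N.
  have [q q_simple y_last] := to_path x y; apply: leq_trans (longest _ _ q_simple).
  by case: q y_last x_y {q_simple} => //= ->; rewrite eqxx.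
exists a, p; split=> //.
- exact: longest_path_leaf p_simple p_gt0 longest.
- have size_rev : size (rev (belast a p)) = size p by rewrite size_rev size_belast.
  apply: (@longest_path_leaf (last a p) (rev (belast a p))) => //; rewrite ?size_rev //.
  case/andP: p_simple => p_path p_uniq; apply/andP; split.
    by rewrite rev_path; under eq_path do rewrite e_sym.
  by rewrite -rev_rcons -lastI rev_uniq.
- apply: leq_trans (card_graph_ball a (size p) deg_le).
  rewrite -cardsT subset_leq_card //; apply/fintype.subsetP => z _.
  have [q q_simple ->] := to_path a z.
  apply: fintype.subsetP (graph_ball_mono a (longest _ _ q_simple)) _ _.
  by apply: graph_ball_path; case/andP: q_simple.
Qed.

End Graph.

(** * The Dirichlet-to-Neumann matrix and the Dirichlet energy *)

Section Dirichlet.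
Variables (R : realType) (V : finType) (e : rel V).
Implicit Types f g u h : {ffun V -> R}.

(** Each edge is counted in both directions, so that [dirichlet f f] is twice
    the usual Dirichlet energy of [f]. *)
Definition dirichlet f g : R :=
  \sum_x \sum_(y | e x y) (f x - f y) * (g x - g y).

Lemma dirichletC f g : dirichlet f g = dirichlet g f.
Proof. by apply: eq_bigr => x _; apply: eq_bigr => y _; rewrite mulrC. Qed.

Lemma dirichlet_ge0 f : 0 <= dirichlet f f.
Proof. by do 2![apply: sumr_ge0 => ? _]; rewrite -expr2 sqr_ge0. Qed.

Lemma dirichlet_split f g :
  dirichlet g g = dirichlet f f + dirichlet (g - f) (g - f) + dirichlet f (g - f) *+ 2.
Proof.
rewrite /dirichlet -sumrMnl -!big_split /=; apply: eq_bigr => x _.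
rewrite -sumrMnl -!big_split /=; apply: eq_bigr => y _.
by rewrite !ffunE; ring.
Qed.

Hypothesis e_sym : symmetric e.

(** The discrete Green formula: exchanging the ends of each edge in one of the
    two copies of the sum turns [g x] into [- g y]. *)
Lemma dirichlet_green f g : dirichlet f g = (\sum_x laplacian e f x * g x) *+ 2.
Proof.
rewrite mulr2n.
have swap : \sum_x laplacian e f x * g x = \sum_x \sum_(y | e x y) (f y - f x) * g y.
  rewrite [RHS](exchange_big_dep xpredT) //=; apply: eq_bigr => x _.
  by rewrite mulr_suml; apply: eq_bigl => y; rewrite e_sym.
rewrite [in X in _ + X]swap -big_split /=; apply: eq_bigr => x _.
by rewrite mulr_suml -big_split /=; apply: eq_bigr => y _; ring.
Qed.

Hypothesis e_conn : forall x y, connect e x y.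

Lemma dirichlet_eq0_const f : dirichlet f f = 0 -> forall x y, f x = f y.
Proof.
move=> f0 x y.
have sq_ge0 (z t : V) : e z t -> 0 <= (f z - f t) * (f z - f t).
  by rewrite -expr2 sqr_ge0.
have edge z t : e z t -> f z = f t.
  move=> ezt; apply/eqP; rewrite -subr_eq0 -[_ == _]orbb -mulf_eq0.
  move/eqP: f0; rewrite psumr_eq0 => [/allP/(_ z)|w _]; last exact: sumr_ge0 (sq_ge0 w).
  rewrite mem_index_enum => /(_ isT); rewrite psumr_eq0 => [/allP/(_ t)|w]; last exact: sq_ge0.
  by rewrite mem_index_enum ezt => /(_ isT).
have /connectP[p p_path ->] := e_conn x y.
elim: p x p_path => //= z p IHp x /andP[/edge -> ]; exact: IHp.
Qed.

Lemma laplacianB f g x : laplacian e (f - g) x = laplacian e f x - laplacian e g x.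
Proof. by rewrite /laplacian -sumrB; apply: eq_bigr => y _; rewrite !ffunE; ring. Qed.

Lemma laplacianD f g x : laplacian e (f + g) x = laplacian e f x + laplacian e g x.
Proof. by rewrite /laplacian -big_split; apply: eq_bigr => y _; rewrite !ffunE /=; ring. Qed.

Lemma laplacianZ (a : R) f x : laplacian e [ffun x => a * f x] x = a * laplacian e f x.
Proof. by rewrite /laplacian mulr_sumr; apply: eq_bigr => y _; rewrite !ffunE; ring. Qed.

Variable b0 : V.
Hypothesis b0_boundary : b0 \in boundary e.

Lemma dirichlet_harmonic u h :
  {in interior_vertices e, forall x, laplacian e u x = 0} ->
  {in boundary e, forall x, h x = 0} -> dirichlet u h = 0.
Proof.
move=> u_harm h0; rewrite dirichlet_green big1 ?mul0rn // => x _.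
have [/h0 ->|x_int] := boolP (x \in boundary e); first by rewrite mulr0.
by rewrite u_harm ?mul0r // inE.
Qed.

(** The energy of [u] is the sum of [laplacian e u x * u x], each term of which
    vanishes, so [u] is constant. *)
Lemma harmonic_unique u :
  {in interior_vertices e, forall x, laplacian e u x = 0} ->
  {in boundary e, forall x, u x = 0} -> u = 0.
Proof.
move=> u_harm u0; have /dirichlet_eq0_const u_const := dirichlet_harmonic u_harm u0.
by apply/ffunP => x; rewrite (u_const x b0) u0 // ffunE.
Qed.

(** The square linear system whose solutions are the extensions with prescribed
    values on the boundary and prescribed Laplacian in the interior. The type
    [R^o] makes [{ffun V -> R^o}] a vector space over [R]. *)
Definition boundary_problem (u : {ffun V -> R^o}) : {ffun V -> R^o} :=
  [ffun x => if x \in boundary e then u x else laplacian e u x].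

Lemma boundary_problem_linear : linear boundary_problem.
Proof.
move=> a f g; apply/ffunP => x; rewrite !ffunE; case: ifP => // _.
by rewrite laplacianD; congr (_ + _); rewrite /GRing.scale /= -laplacianZ.
Qed.

(** A linear endomorphism of a finite-dimensional space that is injective, here
    by [harmonic_unique], is surjective. *)
Lemma boundary_problem_surj (h : {ffun V -> R}) : exists u : {ffun V -> R}, boundary_problem u = h.
Proof.
pose T : {linear {ffun V -> R^o} -> {ffun V -> R^o}} :=
  HB.pack boundary_problem
    (GRing.isLinear.Build R {ffun V -> R^o} {ffun V -> R^o} *:%R _ boundary_problem_linear).
have T_inj : lker (linfun T) == 0%VS.
  apply/lker0P => u v; rewrite !lfunE /= => /ffunP Tuv.
  apply/eqP; rewrite -subr_eq0; apply/eqP; apply: harmonic_unique => x x_in.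
    move: (Tuv x); rewrite !ffunE laplacianB; rewrite inE in x_in.
    by rewrite (negPf x_in) => ->; rewrite subrr.
  by move: (Tuv x); rewrite !ffunE x_in => ->; rewrite subrr.
exists ((linfun T)^-1%VF h).
by have := lker0_lfunVK T_inj h; rewrite lfunE.
Qed.

Local Notation bd := 'rV[R]_#|boundary e|.
Local Notation hext := (@harmonic_extension R V e).

Lemma harmonic_extensionP (f : bd) : is_harmonic_extension f (hext f).
Proof.
apply: xgetPex.
have [u /ffunP u_eq] := boundary_problem_surj
  [ffun x => if x \in boundary e then f 0 (enum_rank_in b0_boundary x) else 0].
exists u; split=> [x|i].
  by rewrite inE => /negPf x_int; move: (u_eq x); rewrite !ffunE x_int.
by move: (u_eq (enum_val i)); rewrite !ffunE enum_valP enum_valK_in.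
Qed.

Lemma harmonic_extension_unique (f : bd) u : is_harmonic_extension f u -> hext f = u.
Proof.
have [hext_harm hext_f] := harmonic_extensionP f; case=> u_harm u_f.
apply/eqP; rewrite -subr_eq0; apply/eqP; apply: harmonic_unique => x x_in.
  by rewrite laplacianB hext_harm // u_harm // subrr.
by rewrite !ffunE -(enum_rankK_in b0_boundary x_in) hext_f u_f subrr.
Qed.

Hypothesis V_ge3 : (3 <= #|V|)%N.

(** The only neighbour of a leaf is an interior vertex. *)
Lemma normal_derivativeE u x : x \in boundary e -> normal_derivative e u x = laplacian e u x.
Proof.
move=> x_bd; rewrite /normal_derivative /laplacian; apply: eq_bigl => y.
by apply: andb_idl; exact: leaf_neighbor_interior.
Qed.

Lemma dirichlet_to_neumann_linear : linear (@dirichlet_to_neumann R V e : bd -> bd).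
Proof.
move=> a f g; have [f_harm f_bd] := harmonic_extensionP f.
have [g_harm g_bd] := harmonic_extensionP g.
have -> : @dirichlet_to_neumann R V e (a *: f + g) =
    \row_i normal_derivative e ([ffun x => a * hext f x] + hext g) (enum_val i).
  rewrite /dirichlet_to_neumann; apply/rowP => i; rewrite !mxE.
  congr (normal_derivative e _ _); apply: harmonic_extension_unique; split=> [x x_int|j].
    by rewrite laplacianD laplacianZ f_harm // g_harm // mulr0 addr0.
  by rewrite !ffunE f_bd g_bd !mxE.
apply/rowP => i; rewrite !mxE !normal_derivativeE ?enum_valP //.
by rewrite laplacianD laplacianZ.
Qed.

Definition dtn_mx : 'M[R]_#|boundary e| := lin1_mx (@dirichlet_to_neumann R V e).

Lemma dtn_mxE (f : bd) : f *m dtn_mx = dirichlet_to_neumann f.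
Proof.
pose F : {linear bd -> bd} :=
  HB.pack (@dirichlet_to_neumann R V e)
    (GRing.isLinear.Build R bd bd *:%R _ dirichlet_to_neumann_linear).
exact: (mul_rV_lin1 F f).
Qed.

(** In the Green formula for the two harmonic extensions only the boundary terms
    survive, and there the Laplacian is the normal derivative. *)
Lemma dtn_mx_form (f g : bd) :
  (f *m dtn_mx *m g^T) 0 0 *+ 2 = dirichlet (hext f) (hext g).
Proof.
have [f_harm f_bd] := harmonic_extensionP f.
have [g_harm g_bd] := harmonic_extensionP g.
rewrite dtn_mxE dirichlet_green; congr (_ *+ 2).
rewrite (bigID (mem (boundary e))) /= [X in _ = _ + X]big1 ?addr0 => [|x x_int]; last first.
  by rewrite f_harm ?mul0r // inE.
rewrite big_enum_val mxE; apply: eq_bigr => i _.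
by rewrite !mxE normal_derivativeE ?enum_valP // g_bd.
Qed.

Lemma dtn_mx_sym : dtn_mx^T = dtn_mx.
Proof.
apply/matrixP => i j.
have entry k l : dtn_mx k l = ((delta_mx 0 k : bd) *m dtn_mx *m (delta_mx 0 l : bd)^T) 0 0.
  rewrite -rowE [RHS]mxE (bigD1 l) //= big1 ?addr0 => [|m m_l].
    by rewrite [row _ _ _ _]mxE [_^T _ _]mxE [delta_mx _ _ _ _]mxE !eqxx mulr1.
  by rewrite [_^T _ _]mxE [delta_mx _ _ _ _]mxE (negPf m_l) andbF mulr0.
rewrite mxE !entry; apply/eqP; rewrite -(eqr_pMn2r (n := 2)) //.
by rewrite !dtn_mx_form dirichletC.
Qed.

Lemma dtn_mx_psd (f : bd) : 0 <= (f *m dtn_mx *m f^T) 0 0.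
Proof. by rewrite -(pmulrn_lge0 _ (n := 2)) // dtn_mx_form dirichlet_ge0. Qed.

Lemma dtn_mx_const : (const_mx 1 : bd) *m dtn_mx = 0.
Proof.
rewrite dtn_mxE /dirichlet_to_neumann.
rewrite (@harmonic_extension_unique _ [ffun=> 1]); last first.
  split=> [x _|i]; last by rewrite ffunE mxE.
  by rewrite /laplacian big1 // => y _; rewrite !ffunE subrr.
apply/rowP => i; rewrite !mxE /normal_derivative big1 // => y _.
by rewrite !ffunE subrr.
Qed.

(** The Dirichlet principle: the difference between [u] and the harmonic
    extension vanishes on the boundary, hence is orthogonal to the harmonic
    extension for the Dirichlet form. *)
Lemma dtn_mx_le_dirichlet (f : bd) u : (forall i, u (enum_val i) = f 0 i) ->
  (f *m dtn_mx *m f^T) 0 0 *+ 2 <= dirichlet u u.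
Proof.
move=> u_f; have [f_harm f_bd] := harmonic_extensionP f.
rewrite dtn_mx_form (dirichlet_split (hext f) u) (dirichlet_harmonic (h := u - hext f) f_harm) //.
  by rewrite mul0rn addr0 lerDl dirichlet_ge0.
by move=> x x_bd; rewrite !ffunE -(enum_rankK_in b0_boundary x_bd) f_bd u_f subrr.
Qed.

(** The test vector is the restriction of [g] to the boundary minus its mean
    [m], which makes it orthogonal to the constants. Its squared norm is at least
    [(g a - m) ^ 2 + (g b - m) ^ 2 >= (g a - g b) ^ 2 / 2], and the factor 2 is
    that of [dirichlet], which counts every edge twice. *)
Lemma steklov_lambda2_le g a b : a \in boundary e -> b \in boundary e -> g a != g b ->
  0 <= steklov_lambda2 R e <= dirichlet g g / (g a - g b) ^+ 2.
Proof.
move=> a_bd b_bd gab.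
have gab0 : 0 < (g a - g b) ^+ 2 by rewrite exprn_even_gt0 //= subr_eq0.
have bd_gt0 : 0 < #|boundary e|%:R :> R.
  by rewrite ltr0n; apply/card_gt0P; exists b0.
pose m := (\sum_(x in boundary e) g x) / #|boundary e|%:R.
pose v : bd := \row_i (g (enum_val i) - m).
have vv : (v *m v^T) 0 0 = \sum_(x in boundary e) (g x - m) ^+ 2.
  by rewrite big_enum_val mxE; apply: eq_bigr => i _; rewrite !mxE expr2.
have vv_ge : (g a - g b) ^+ 2 <= (v *m v^T) 0 0 *+ 2.
  rewrite vv (bigD1 a) //= (bigD1 b) /=; last by rewrite b_bd; apply: contra_neq gab => ->.
  have : 0 <= \sum_(i in boundary e | (i != a) && (i != b)) (g i - m) ^+ 2.
    by apply: sumr_ge0 => x _; exact: sqr_ge0.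
  under [in X in _ -> X]eq_bigl do rewrite -andbA.
  move: (\sum_(i in _ | _) _) => r r_ge0.
  have : 0 <= ((g a - m) + (g b - m)) ^+ 2 by exact: sqr_ge0.
  rewrite -mulr_natr; nra.
apply: (@symmetric_second_eigenvalue _ _ dtn_mx (const_mx 1) v).
- exact: dtn_mx_sym.
- exact: dtn_mx_psd.
- by rewrite divr_ge0 ?dirichlet_ge0 ?ltW.
- apply/eqP => /rowP/(_ (enum_rank_in b0_boundary b0)); rewrite !mxE => /eqP.
  by rewrite oner_eq0.
- exact: dtn_mx_const.
- apply: contraTneq vv_ge => ->; rewrite mul0mx mxE mul0rn -ltNge //.
- apply/matrixP => i j; rewrite !ord1 !mxE; under eq_bigr do rewrite !mxE mulr1.
  rewrite -(big_enum_val (fun x => g x - m)) sumrB sumr_const -[m *+ _]mulr_natr /m.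
  by rewrite mulfVK ?subrr // gt_eqF.
- rewrite -(ler_pMn2r (n := 2)) //.
  apply: (@le_trans _ _ (dirichlet g g)).
    have -> : dirichlet g g = dirichlet [ffun x => g x - m] [ffun x => g x - m].
      apply: eq_bigr => x _; apply: eq_bigr => y _; rewrite !ffunE; ring.
    by apply: dtn_mx_le_dirichlet => i; rewrite ffunE mxE.
  rewrite -mulrnAr mulrAC ler_pdivlMr // ler_wpM2l // dirichlet_ge0 //.
Qed.
End Dirichlet.

(** * The position along a path as a test function *)

Section PathPotential.
Variables (R : realType) (V : finType) (e : rel V) (a : V) (p : seq V).
Hypotheses (tree : is_tree e) (p_simple : simple_path e a p).
Let s i := nth a (a :: p) i.
Let cut i := delete_edge e (s i) (s i.+1).
Let b := last a p.

(** On a tree, the term of index [i] is 1 when [x] lies on the side of [b] of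
    the [i]-th edge of the path, so the sum is the position along the path of
    the projection of [x] onto it. *)
Definition path_potential : {ffun V -> R} :=
  [ffun x => \sum_(i < size p) (connect (cut i) b x)%:R].

Let e_sym : symmetric e. Proof. by case: tree. Qed.

Let s_edge i : (i < size p)%N -> e (s i) (s i.+1).
Proof. by case/andP: p_simple => /(pathP a) p_path _; exact: p_path. Qed.

Let s_inj i j : (i <= size p)%N -> (j <= size p)%N -> (s i == s j) = (i == j).
Proof. by move=> i_le j_le; apply: nth_uniq => //; case/andP: p_simple. Qed.

Let s_size : s (size p) = b.
Proof. by rewrite /s /b (last_nth a). Qed.

Let cut_sym i : connect_sym (cut i).
Proof. exact/sym_connect_sym/delete_edge_sym. Qed.

Let cut_edge i j : (i < size p)%N -> (j < size p)%N -> i != j -> cut i (s j) (s j.+1).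
Proof.
move=> i_lt j_lt i_j; rewrite /cut /delete_edge /= s_edge //=.
have [i_le j_le] := (ltnW i_lt, ltnW j_lt).
by rewrite !s_inj //; move: i_j; clear; lia.
Qed.

Let connect_cut i j k : (i < size p)%N -> (j <= k <= size p)%N ->
  (k <= i)%N || (i < j)%N -> connect (cut i) (s j) (s k).
Proof.
move=> i_lt /andP[/subnK <-]; elim: (k - j)%N => [|m IHm] /=; first by rewrite connect0.
rewrite addSn => le_p i_out; apply: connect_trans (IHm _ _) (connect1 (cut_edge _ _ _)); lia.
Qed.

Lemma path_potential_last : path_potential b = (size p)%:R.
Proof.
rewrite ffunE; under eq_bigr do rewrite connect0.
by rewrite sumr_const card_ord.
Qed.

Lemma path_potential_head : path_potential a = 0.
Proof.
rewrite ffunE big1 // => i _; have i_lt := ltn_ord i.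
have := tree_bridge tree (s_edge i_lt); rewrite -/(cut i) => cut_i.
have [b_a|//] := boolP (connect (cut i) b a).
case/negP: cut_i; apply: connect_trans (_ : connect (cut i) _ b) _.
  by rewrite -s_size; apply: connect_cut; lia.
apply: connect_trans b_a _.
by apply: (connect_cut (j := 0%N)); lia.
Qed.

Let is_edge i x y := ([&& x == s i & y == s i.+1] || [&& x == s i.+1 & y == s i]).

Let is_edge_uniq i j x y : (i < size p)%N -> (j < size p)%N ->
  is_edge i x y -> is_edge j x y -> i = j.
Proof.
move=> i_lt j_lt; have [i_le j_le] := (ltnW i_lt, ltnW j_lt).
rewrite /is_edge => /orP[] /andP[/eqP -> /eqP ->]; rewrite !s_inj //; clear; lia.
Qed.

(** An edge that is not on the path survives the deletion of any path edge, so
    its ends have the same potential; an edge on the path is affected by its own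
    deletion only, because the path is simple. *)
Lemma path_potential_edge x y : e x y ->
  (path_potential x - path_potential y) ^+ 2 <= \sum_(i < size p) (is_edge i x y)%:R.
Proof.
move=> exy; rewrite !ffunE -sumrB.
have same i : ~~ is_edge i x y -> connect (cut i) b x = connect (cut i) b y.
  move=> not_edge; apply: same_connect_r => //; apply: connect1.
  by rewrite /cut /delete_edge /= exy not_edge.
have [/existsP[i i_edge]|] := boolP [exists i : 'I_(size p), is_edge i x y]; last first.
  rewrite negb_exists => /forallP none; rewrite !big1 ?expr0n // => i _.
  - by rewrite (negPf (none i)).
  - by rewrite same ?none ?subrr.
rewrite (bigD1 i) //= big1 ?addr0 => [|j j_i]; last first.
  rewrite same ?subrr //; apply: contraNN j_i => j_edge; apply/eqP/val_inj.
  exact: is_edge_uniq j_edge i_edge.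
rewrite (bigD1 i) //= i_edge; apply: (@le_trans _ _ 1); last first.
  by rewrite lerDl sumr_ge0.
by case: (connect _ b x); case: (connect _ b y);
  rewrite ?subrr ?subr0 ?sub0r ?sqrrN ?expr1n ?expr0n.
Qed.

(** Each of the [size p] edges of the path is counted in both directions. *)
Lemma path_potential_dirichlet :
  dirichlet e path_potential path_potential <= (size p)%:R *+ 2.
Proof.
apply: (@le_trans _ _ (\sum_x \sum_y \sum_(i < size p) (is_edge i x y)%:R)).
  apply: ler_sum => x _; rewrite [leRHS](bigID (e x)) /=.
  rewrite -[leLHS]addr0 lerD //; last by do 2![apply: sumr_ge0 => ? _].
  by apply: ler_sum => y exy; rewrite -expr2 path_potential_edge.
under eq_bigr do rewrite exchange_big /=.
rewrite exchange_big /= -[X in X%:R *+ 2](card_ord (size p)) -sumr_const -sumrMnl.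
apply: ler_sum => i _.
have one (z t : V) : \sum_x \sum_y ((x == z) && (y == t))%:R = 1 :> R.
  rewrite (bigD1 z) //= (bigD1 t) //= !eqxx /= !big1 ?addr0 // => [x /negPf xz|y /negPf ->] //.
  by rewrite big1 // => y _; rewrite xz.
rewrite mulr2n -[X in X + _](one (s i) (s i.+1)) -[X in _ + X](one (s i.+1) (s i)).
rewrite -big_split /=; apply: ler_sum => x _; rewrite -big_split /=.
apply: ler_sum => y _; rewrite /is_edge.
by case: (_ && _); case: (_ && _); rewrite /= ?addr0 ?add0r ?lerDl.
Qed.

End PathPotential.

(** * Trees of bounded degree and growing size *)

(** The potential of a longest path of length [L] has [dirichlet] at most
    [2 L] and rises by [L] between its ends, whence the bound
    [2 L / L ^ 2]. *)
Theorem steklov_lambda2_tree_le (R : realType) (D : nat) (V : finType) (e : rel V) :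
  is_tree e -> (3 <= #|V|)%N -> (forall x, degree e x <= D)%N ->
  exists L, [/\ (0 < L)%N, (#|V| <= D.+1 ^ L)%N & 0 <= steklov_lambda2 R e <= 2 / L%:R].
Proof.
move=> tree V_ge3 deg_le; have [e_sym e_irr e_conn _] := tree.
have [a [p [p_simple p_gt0 a_bd b_bd V_le]]] := tree_long_path tree (ltnW V_ge3) deg_le.
exists (size p); split=> //.
pose g := path_potential R e a p.
have g_a : g a = 0 by exact: path_potential_head.
have g_b : g (last a p) = (size p)%:R by exact: path_potential_last.
have p_neq0 : (size p)%:R != 0 :> R by rewrite pnatr_eq0 -lt0n.
have g_ab : g a != g (last a p) by rewrite g_a g_b eq_sym.
have /andP[-> /le_trans -> //] :=
  steklov_lambda2_le e_sym e_conn a_bd V_ge3 a_bd b_bd g_ab.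
rewrite g_a g_b sub0r sqrrN ler_pdivrMr ?exprn_gt0 ?ltr0n //.
have -> : 2 / (size p)%:R * (size p)%:R ^+ 2 = (size p)%:R *+ 2 :> R.
  by rewrite expr2 mulrA mulfVK // mulr_natl.
exact: path_potential_dirichlet.
Qed.

Local Open Scope classical_set_scope.

Theorem corollary1p4 (R : realType) (D : nat) (V : nat -> finType)
    (e : forall n, rel (V n))
    (D_gt0 : (0 < D)%N)
    (tree_e : forall n, is_tree (e n))
    (card_V : forall n, (3 <= #|V n|)%N)
    (degree_le : forall n (x : V n), (degree (e n) x <= D)%N)
    (card_cvg : #|V n| @[n --> \oo] --> \oo) :
  steklov_lambda2 R (e n) @[n --> \oo] --> (0 : R).
Proof.
apply/cvgr0Pnorm_lt => eps eps_gt0.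
pose K := Num.truncn (2 / eps).
have lt_K : 2 / eps < K.+1%:R by exact: truncnS_gt.
move/cvgnyPgt: card_cvg => /(_ (D.+1 ^ K)%N); apply: filterS => n V_gt.
have [L [L_gt0 V_le /andP[l_ge0 l_le]]] :=
  steklov_lambda2_tree_le R (tree_e n) (card_V n) (degree_le n).
have K_lt_L : (K < L)%N by rewrite -(ltn_exp2l _ _ (m := D.+1)) //; exact: leq_trans V_gt V_le.
rewrite ger0_norm //; apply: le_lt_trans l_le _.
rewrite ltr_pdivrMr ?ltr0n // mulrC -ltr_pdivrMr //.
by apply: lt_le_trans lt_K _; rewrite ler_nat.
Qed.
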